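(* Let $p\geqslant1$ and let $f_i:\mathbb{R}^D\to\mathbb{R}^D$, $f_i(x)=A_ix$, $i\in\{1,\ldots,p\}$, be linear maps, with $\mathcal{M}=\{A_1,\ldots,A_p\}$. Let $K_0\in\mathcal{K}$. Assume that there exists $d>0$ such that $\big(H_d^n(K_0)\big)_n$ converges to a set $L\in\mathcal{K}$ with $\rho(L)\neq0$. Then: (i) $(d_n)_n$ converges to $d$ and $d\leqslant\sigma_{\mathcal{M}}$; (ii) $(K_n)_n$ converges to $K=\frac1{\rho(L)}L$.
   Context: $D\geqslant1$; $\|\cdot\|$ is the Euclidean norm on $\mathbb{R}^D$ and also the induced operator norm on $D\times D$ real matrices. $\mathcal{K}$ is the set of non-empty compact subsets of $\mathbb{R}^D$, with the Hausdorff metric; convergence of sets is with respect to this metric. The radius function is $\rho(K)=\sup\{\|x\|:x\in K\}$. The Hutchinson operator is $H(K)=\bigcup_{i=1}^p f_i(K)$; for $d>0$, $H_d=\frac1d H$, i.e. $H_d(K)=\bigcup_{i=1}^p\frac1d f_i(K)$; the renormalized operator is $H_\rho(K)=\frac{1}{\rho(H(K))}H(K)$. For $K_0\in\mathcal{K}$ put $K_n=H_\rho^n(K_0)$ and $d_n=\rho(H(K_n))$, so that $K_{n+1}=\frac1{d_n}H(K_n)$. Standing assumption: $d_n>0$ for all $n\geqslant0$. The joint spectral radius of $\mathcal{M}$ is $\sigma_{\mathcal{M}}=\limsup_{n\to\infty}\big(\sup_{1\leqslant i_1,\ldots,i_n\leqslant p}\|A_{i_1}\cdots A_{i_n}\|\big)^{1/n}$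 (equivalently, with the spectral radius of $A_{i_1}\cdots A_{i_n}$ in place of its norm). *)

(* Defs.v *)
From HB Require Import structures.
From mathcomp Require Import all_boot all_order all_algebra.
From mathcomp Require Import all_classical all_reals all_analysis.
Set Implicit Arguments.
Unset Strict Implicit.
Unset Printing Implicit Defensive.
Import Order.TTheory GRing.Theory Num.Theory numFieldNormedType.Exports.
Local Open Scope classical_set_scope.
Local Open Scope ring_scope.

(* The norm that the library puts on matrices is the max norm, so the Euclidean
   norm and its operator norm are defined by hand. *)
Definition enorm (R : realType) (D : nat) (x : 'cV[R]_D) : R :=
  Num.sqrt (\sum_(i < D) x i 0 ^+ 2).

Definition opnorm (R : realType) (D : nat) (A : 'M[R]_D) : R :=
  sup [set enorm (A *m x) | x in [set x : 'cV[R]_D | enorm x <= 1]].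

(* Compactness refers to the library topology on matrices (entrywise
   convergence), which is also the topology of the Euclidean norm. *)
Definition nonempty_compact (R : realType) (D : nat) : set (set 'cV[R]_D) :=
  [set K | K !=set0 /\ compact K].

Definition dist_to_set (R : realType) (D : nat) (x : 'cV[R]_D)
    (B : set 'cV[R]_D) : R :=
  inf [set enorm (x - y) | y in B].

(* A real-valued [sup], meaningful as the arguments are always non-empty and
   bounded. *)
Definition hausdorff_dist (R : realType) (D : nat) (A B : set 'cV[R]_D) : R :=
  Num.max (sup [set dist_to_set x B | x in A])
          (sup [set dist_to_set y A | y in B]).

Definition hausdorff_cvg (R : realType) (D : nat) (U : nat -> set 'cV[R]_D)
    (L : set 'cV[R]_D) : Prop :=
  hausdorff_dist (U n) L @[n --> \oo] --> (0 : R).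

Definition set_radius (R : realType) (D : nat) (K : set 'cV[R]_D) : R :=
  sup [set enorm x | x in K].

Definition scale_set (R : realType) (D : nat) (c : R) (K : set 'cV[R]_D) :
    set 'cV[R]_D :=
  [set c *: x | x in K].

Section Hutchinson.
Variables (R : realType) (D p : nat) (f : 'I_p -> 'cV[R]_D -> 'cV[R]_D).

Definition hutchinson (K : set 'cV[R]_D) : set 'cV[R]_D :=
  \bigcup_(i in [set: 'I_p]) f i @` K.

Definition hutchinson_div (d : R) (K : set 'cV[R]_D) : set 'cV[R]_D :=
  scale_set d^-1 (hutchinson K).

Definition hutchinson_renorm (K : set 'cV[R]_D) : set 'cV[R]_D :=
  scale_set (set_radius (hutchinson K))^-1 (hutchinson K).

Definition renorm_orbit (K0 : set 'cV[R]_D) (n : nat) : set 'cV[R]_D :=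
  iter n hutchinson_renorm K0.

Definition renorm_factor (K0 : set 'cV[R]_D) (n : nat) : R :=
  set_radius (hutchinson (renorm_orbit K0 n)).

End Hutchinson.

(* The upper limit is taken in the extended reals, where it always exists; the
   term of index 0 plays no role. *)
Definition joint_spectral_radius (R : realType) (D p : nat)
    (A : 'I_p -> 'M[R]_D) : \bar R :=
  limn_esup (fun n : nat =>
    (sup [set opnorm (\prod_(k < n) A (w k)) | w in [set: {ffun 'I_n -> 'I_p}]]
       `^ n%:R^-1)%:E).

(* Main.v *)
Require Import Defs.
From mathcomp Require Import all_boot all_order all_algebra.
From mathcomp Require Import all_classical all_reals all_analysis.
From mathcomp Require Import ring lra.
Import Order.TTheory GRing.Theory Num.Theory numFieldNormedType.Exports.
Local Open Scope classical_set_scope.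
Local Open Scope ring_scope.

(** Write [U_n] for the iterates of [H_d] on [K_0]; they converge to [L]. The
    maps are linear, so [H] commutes with positive scalings, and a renormalized
    orbit forgets any factor applied to its points: for [n >= 1],
    [K_n = rho(U_n)^-1 U_n] and [d_n = d rho(U_(n+1)) / rho(U_n)]
    ([renorm_orbit_scale]). The radius is 1-Lipschitz for the Hausdorff distance
    ([set_radius_lipschitz]), hence [rho(U_n)] tends to [rho(L)], which is
    nonzero, and [d_n] tends to [d]. Scaling is jointly continuous in the factor
    and the set ([hausdorff_dist_scale]), hence [K_n] tends to [rho(L)^-1 L].

    For the joint spectral radius, each point of [U_n] is [d^-n] times the image
    of a point of [K_0] by a product of [n] of the matrices. So the largest norm
    of such a product is at least [d^n rho(U_n) / rho(K_0)], eventually at least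
    [c d^n] with a constant [c > 0], and its [n]-th root has upper limit at
    least [d] ([joint_spectral_radius_ge], [le_joint_spectral_radius]). *)

(** * The Euclidean norm and its operator norm *)

Section EuclideanNorm.
Context {R : realType} {D : nat}.
Implicit Types (x y : 'cV[R]_D) (M : 'M[R]_D).

Lemma enorm_ge0 x : 0 <= enorm x.
Proof. exact: sqrtr_ge0. Qed.

Lemma sqr_enorm x : enorm x ^+ 2 = \sum_i x i 0 ^+ 2.
Proof. by rewrite sqr_sqrtr// sumr_ge0// => i _; exact: sqr_ge0. Qed.

Lemma enormZ (c : R) x : enorm (c *: x) = `|c| * enorm x.
Proof.
rewrite /enorm -sqrtr_sqr -sqrtrM ?sqr_ge0// mulr_sumr.
by congr Num.sqrt; apply: eq_bigr => i _; rewrite mxE exprMn.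
Qed.

Lemma enormN x : enorm (- x) = enorm x.
Proof. by rewrite -scaleN1r enormZ normrN1 mul1r. Qed.

Lemma enorm0 : enorm (0 : 'cV[R]_D) = 0.
Proof. by rewrite -(scale0r 0) enormZ normr0 mul0r. Qed.

Lemma enormBC x y : enorm (x - y) = enorm (y - x).
Proof. by rewrite -opprB enormN. Qed.

Lemma coord_le_enorm x i : `|x i 0| <= enorm x.
Proof.
rewrite -(@ler_pXn2r _ 2)// ?nnegrE ?enorm_ge0// sqr_enorm real_normK ?num_real//.
by rewrite (bigD1 i)//= lerDl sumr_ge0// => j _; exact: sqr_ge0.
Qed.

Lemma enorm_le_sum x : enorm x <= \sum_i `|x i 0|.
Proof.
have S0 : 0 <= \sum_i `|x i 0| by apply: sumr_ge0.
rewrite -(@ler_pXn2r _ 2)// ?nnegrE ?enorm_ge0// sqr_enorm [leRHS]expr2.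
rewrite mulr_suml; apply: ler_sum => i _.
rewrite -real_normK ?num_real// expr2 ler_wpM2l//.
by rewrite (bigD1 i)//= lerDl sumr_ge0.
Qed.

(** Cauchy-Schwarz, from expanding the square of the norm of
    [enorm y *: x - enorm x *: y]. *)
Lemma dot_le_enormM x y : \sum_i x i 0 * y i 0 <= enorm x * enorm y.
Proof.
have [x0|x_neq0] := eqVneq (enorm x) 0.
  rewrite x0 mul0r big1// => i _.
  suff -> : x i 0 = 0 by rewrite mul0r.
  by apply/eqP; rewrite -normr_le0 -x0 coord_le_enorm.
have [y0|y_neq0] := eqVneq (enorm y) 0.
  rewrite y0 mulr0 big1// => i _.
  suff -> : y i 0 = 0 by rewrite mulr0.
  by apply/eqP; rewrite -normr_le0 -y0 coord_le_enorm.
have xy_gt0 : 0 < enorm x * enorm y.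
  by rewrite mulr_gt0// lt_neqAle eq_sym enorm_ge0 ?x_neq0 ?y_neq0.
rewrite -(ler_pM2l xy_gt0).
have : 0 <= enorm (enorm y *: x - enorm x *: y) ^+ 2 by exact: sqr_ge0.
rewrite sqr_enorm.
have -> : \sum_i (enorm y *: x - enorm x *: y) i 0 ^+ 2 =
   enorm y ^+ 2 * enorm x ^+ 2 + enorm x ^+ 2 * enorm y ^+ 2
   - (enorm x * enorm y * \sum_i x i 0 * y i 0) *+ 2.
  rewrite [in enorm y ^+ 2 * enorm x ^+ 2](sqr_enorm x).
  rewrite [in enorm x ^+ 2 * enorm y ^+ 2](sqr_enorm y).
  rewrite -mulr_natl !mulr_sumr -sumrN -!big_split/=.
  by apply: eq_bigr => i _; rewrite !mxE; ring.
by set s := \sum_i _; move: (enorm x) (enorm y) => a b; nra.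
Qed.

Lemma ler_enormD x y : enorm (x + y) <= enorm x + enorm y.
Proof.
rewrite -(@ler_pXn2r _ 2)// ?nnegrE ?addr_ge0 ?enorm_ge0//.
rewrite sqrrD !sqr_enorm.
have -> : \sum_i (x + y) i 0 ^+ 2 =
    \sum_i x i 0 ^+ 2 + (\sum_i x i 0 * y i 0) *+ 2 + \sum_i y i 0 ^+ 2.
  rewrite -mulr_natl mulr_sumr -!big_split/=.
  by apply: eq_bigr => i _; rewrite !mxE; ring.
by rewrite lerD2r lerD2l ler_pMn2r// dot_le_enormM.
Qed.

Lemma ler_enormB x y : enorm x <= enorm (x - y) + enorm y.
Proof. by rewrite -{1}(subrK y x) ler_enormD. Qed.

(** A crude bound, which shows that the supremum defining [opnorm] is taken over
    a bounded set. *)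
Lemma enorm_mulmx_le_entries M x :
  enorm (M *m x) <= (\sum_i \sum_j `|M i j|) * enorm x.
Proof.
apply: (le_trans (enorm_le_sum _)); rewrite mulr_suml; apply: ler_sum => i _.
rewrite mxE mulr_suml (le_trans (ler_norm_sum _ _ _))//; apply: ler_sum => j _.
by rewrite normrM ler_wpM2l// coord_le_enorm.
Qed.

Lemma opnorm_ge M x : enorm x <= 1 -> enorm (M *m x) <= opnorm M.
Proof.
move=> x1; apply: ub_le_sup; last by exists x.
exists (\sum_i \sum_j `|M i j|) => _ [y /= y1 <-].
rewrite (le_trans (enorm_mulmx_le_entries _ _))// ler_piMr//.
by apply: sumr_ge0 => i _; apply: sumr_ge0.
Qed.

Lemma opnorm_ge0 M : 0 <= opnorm M.
Proof. by rewrite -enorm0 -(mulmx0 _ M) opnorm_ge// enorm0. Qed.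

Lemma enorm_mulmx_le M x : enorm (M *m x) <= opnorm M * enorm x.
Proof.
have [x0|x_neq0] := eqVneq (enorm x) 0.
  by rewrite (le_trans (enorm_mulmx_le_entries _ _))// x0 !mulr0.
have x_gt0 : 0 < enorm x by rewrite lt_neqAle eq_sym x_neq0 enorm_ge0.
rewrite -ler_pdivrMr// mulrC -[_^-1]ger0_norm ?invr_ge0 ?enorm_ge0//.
rewrite -enormZ scalemxAr opnorm_ge// enormZ ger0_norm ?invr_ge0 ?enorm_ge0//.
by rewrite mulVf.
Qed.

End EuclideanNorm.

(** * Radius and Hausdorff distance of bounded sets *)

(** Boundedness is what keeps the real-valued suprema in [set_radius] and
    [hausdorff_dist] meaningful; unlike compactness, it passes to all iterates
    of the Hutchinson operator by a mere norm estimate. *)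
Definition ebounded {R : realType} {D : nat} (K : set 'cV[R]_D) : Prop :=
  exists B : R, forall x, K x -> enorm x <= B.

Section Hausdorff.
Context {R : realType} {D : nat}.
Implicit Types (x y : 'cV[R]_D) (A B K : set 'cV[R]_D).

Lemma compact_ebounded K : compact K -> ebounded K.
Proof.
move=> /compact_bounded [C [_ CK]]; exists (\sum_(i < D) (C + 1)) => x Kx.
apply: (le_trans (enorm_le_sum x)); apply: ler_sum => i _.
apply: le_trans (CK (C + 1) _ x Kx); last by rewrite ltrDl.
by rewrite [leRHS]mx_normrE; exact: (le_bigmax _ (fun ij => `|x ij.1 ij.2|) (i, 0)).
Qed.

Lemma scale_set_comp (a b : R) K :
  scale_set a (scale_set b K) = scale_set (a * b) K.
Proof.
rewrite /scale_set image_comp.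
by congr image; apply/funext => x /=; rewrite scalerA.
Qed.

Lemma scale_set1 K : scale_set 1 K = K.
Proof.
rewrite /scale_set (_ : (fun x => 1 *: x) = id) ?image_id//.
by apply/funext => x; rewrite scale1r.
Qed.

Lemma scale_set_neq0 (a : R) K : K !=set0 -> scale_set a K !=set0.
Proof. by move=> [x Kx]; exists (a *: x), x. Qed.

Lemma ebounded_scale (c : R) K : ebounded K -> ebounded (scale_set c K).
Proof.
move=> [C KC]; exists (`|c| * C) => _ [x Kx <-].
by rewrite enormZ ler_wpM2l// KC.
Qed.

Lemma enorm_le_radius K x : ebounded K -> K x -> enorm x <= set_radius K.
Proof.
by move=> [C KC] Kx; apply: ub_le_sup; [exists C => _ [y Ky <-]; exact: KC|exists x].
Qed.

Lemma set_radius_le K (C : R) : K !=set0 ->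
  (forall x, K x -> enorm x <= C) -> set_radius K <= C.
Proof.
by move=> [x Kx] KC; apply: ge_sup; [exists (enorm x), x|move=> _ [y Ky <-]; exact: KC].
Qed.

Lemma set_radius_ge0 K : 0 <= set_radius K.
Proof.
have [[[_ [x Kx _]] [C KC]]|nsup] := pselect (has_sup [set enorm x | x in K]).
  by apply: (le_trans (enorm_ge0 x)); apply: ub_le_sup; [exists C|exists x].
by rewrite /set_radius sup_out.
Qed.

Lemma set_radius_scale (c : R) K : ebounded K -> K !=set0 -> 0 <= c ->
  set_radius (scale_set c K) = c * set_radius K.
Proof.
move=> bK K0 c0; have [x Kx] := K0; apply/eqP; rewrite eq_le; apply/andP; split.
  apply: set_radius_le; first by exists (c *: x), x.
  by move=> _ [y Ky <-]; rewrite enormZ ger0_norm// ler_wpM2l// enorm_le_radius.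
have [->|c_neq0] := eqVneq c 0; first by rewrite mul0r set_radius_ge0.
have c_gt0 : 0 < c by rewrite lt_neqAle eq_sym c_neq0.
rewrite -ler_pdivlMl//; apply: set_radius_le => // y Ky.
rewrite ler_pdivlMl// -[X in X * _]ger0_norm// -enormZ.
by apply: enorm_le_radius; [exact: ebounded_scale|exists y].
Qed.

Lemma hausdorff_distC A B : hausdorff_dist A B = hausdorff_dist B A.
Proof. by rewrite /hausdorff_dist maxC. Qed.

Lemma dist_to_set_le x y B : B y -> dist_to_set x B <= enorm (x - y).
Proof.
move=> By; apply: ge_inf; last by exists y.
by exists 0 => _ [z Bz <-]; exact: enorm_ge0.
Qed.

(** This lemma and [hausdorff_dist_le] are the two directions between the
    Hausdorff distance and approximate nearest points. The slack [e] is there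
    because [dist_to_set] is an infimum that a merely bounded set need not
    attain. *)
Lemma hausdorff_dist_near A B x (e : R) : ebounded A -> B !=set0 -> A x ->
  0 < e -> exists2 y, B y & enorm (x - y) <= hausdorff_dist A B + e.
Proof.
move=> [C AC] [z Bz] Ax e0.
have [] := @inf_adherent _ [set enorm (x - y) | y in B] _ e0.
  split; first by exists (enorm (x - z)), z.
  by exists 0 => _ [y By <-]; exact: enorm_ge0.
move=> _ [y By <-] /ltW xy; exists y => //; apply: (le_trans xy).
rewrite lerD2r le_max; apply/orP; left.
apply: ub_le_sup; last by exists x.
exists (C + enorm z) => _ [t At <-]; apply: (le_trans (dist_to_set_le t z B Bz)).
by rewrite (le_trans (ler_enormD _ _))// enormN lerD2r AC.
Qed.

Lemma hausdorff_dist_le A B (e : R) : A !=set0 -> B !=set0 ->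
  (forall x (eps : R), A x -> 0 < eps ->
    exists2 y, B y & enorm (x - y) <= e + eps) ->
  (forall y (eps : R), B y -> 0 < eps ->
    exists2 x, A x & enorm (y - x) <= e + eps) ->
  hausdorff_dist A B <= e.
Proof.
move=> [a Aa] [b Bb] AB BA; rewrite ge_max; apply/andP; split.
- apply: ge_sup; first by exists (dist_to_set a B), a.
  move=> _ [x Ax <-]; apply/ler_addgt0Pr => eps eps0.
  have [y By xy] := AB x eps Ax eps0; exact: le_trans (dist_to_set_le _ _ _ By) xy.
- apply: ge_sup; first by exists (dist_to_set b A), b.
  move=> _ [x Ax <-]; apply/ler_addgt0Pr => eps eps0.
  have [y By xy] := BA x eps Ax eps0; exact: le_trans (dist_to_set_le _ _ _ By) xy.
Qed.

Lemma set_radius_le_hausdorff A B : ebounded A -> ebounded B ->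
  A !=set0 -> B !=set0 -> set_radius A <= hausdorff_dist A B + set_radius B.
Proof.
move=> bA bB A0 B0; apply: set_radius_le => // x Ax.
apply/ler_addgt0Pr => e e0; have [y By xy] := hausdorff_dist_near A B x e bA B0 Ax e0.
rewrite (le_trans (ler_enormB x y))// addrAC lerD// enorm_le_radius//.
Qed.

Lemma set_radius_lipschitz A B : ebounded A -> ebounded B ->
  A !=set0 -> B !=set0 ->
  `|set_radius A - set_radius B| <= hausdorff_dist A B.
Proof.
move=> bA bB A0 B0; rewrite ler_distlC lerBlDl; apply/andP; split.
  by rewrite set_radius_le_hausdorff.
by rewrite addrC hausdorff_distC set_radius_le_hausdorff.
Qed.

Lemma hausdorff_dist_ge0 A B : ebounded A -> ebounded B ->
  A !=set0 -> B !=set0 -> 0 <= hausdorff_dist A B.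
Proof. by move=> *; apply: le_trans (set_radius_lipschitz A B _ _ _ _). Qed.

(** From [a *: x - b *: y = a *: (x - y) + (a - b) *: y], with [y] a nearly
    nearest point to [x]. *)
Lemma hausdorff_dist_scale (a b : R) A B : ebounded A -> ebounded B ->
  A !=set0 -> B !=set0 ->
  hausdorff_dist (scale_set a A) (scale_set b B) <=
  `|a| * hausdorff_dist A B + `|a - b| * set_radius B.
Proof.
move=> bA bB A0 B0; have [[x0 Ax0] [y0 By0]] := (A0, B0).
set e := _ + _.
(* The denominator is [`|a| + 1] rather than [`|a|] so that [a = 0] is
   covered. *)
have close x y (eps : R) : B y -> 0 < eps ->
    enorm (x - y) <= hausdorff_dist A B + eps / (`|a| + 1) ->
    enorm (a *: x - b *: y) <= e + eps.
  move=> By eps0 xy; have a1 : 0 < `|a| + 1 by rewrite ltr_pwDr.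
  have -> : a *: x - b *: y = a *: (x - y) + (a - b) *: y.
    by rewrite scalerBr scalerBl addrA subrK.
  rewrite (le_trans (ler_enormD _ _))// !enormZ /e addrAC lerD//; last first.
    by rewrite ler_wpM2l// enorm_le_radius.
  rewrite (le_trans (ler_wpM2l (normr_ge0 a) xy))// mulrDr lerD2l.
  by rewrite mulrCA ler_piMr// ?(ltW eps0)// ler_pdivrMr// mul1r lerDl.
have eps'_gt0 (eps : R) : 0 < eps -> 0 < eps / (`|a| + 1).
  by move=> eps0; rewrite divr_gt0// ltr_pwDr.
apply: hausdorff_dist_le; [by exists (a *: x0), x0|by exists (b *: y0), y0| |].
- move=> _ eps [x Ax <-] eps0.
  have [y By xy] := hausdorff_dist_near A B x _ bA B0 Ax (eps'_gt0 _ eps0).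
  by exists (b *: y); [exists y|exact: close].
- move=> _ eps [y By <-] eps0.
  have [x Ax yx] := hausdorff_dist_near B A y _ bB A0 By (eps'_gt0 _ eps0).
  exists (a *: x); first by exists x.
  by rewrite enormBC; apply: close => //; rewrite enormBC hausdorff_distC.
Qed.

End Hausdorff.

(** * Growth of products of matrices and joint spectral radius *)

Definition max_product_opnorm {R : realType} {D p : nat} (A : 'I_p -> 'M[R]_D)
    (n : nat) : R :=
  sup [set opnorm (\prod_(k < n) A (w k)) | w in [set: {ffun 'I_n -> 'I_p}]].

Section JointSpectralRadius.
Context {R : realType}.

Lemma opnorm_prod_le_max {D p : nat} (A : 'I_p -> 'M[R]_D) (n : nat)
    (w : {ffun 'I_n -> 'I_p}) :
  opnorm (\prod_(k < n) A (w k)) <= max_product_opnorm A n.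
Proof.
apply: ub_le_sup; last by exists w.
exists (\sum_(v : {ffun 'I_n -> 'I_p}) opnorm (\prod_(k < n) A (v k))).
move=> _ [v _ <-]; rewrite [leRHS](bigD1 v)//= lerDl.
by apply: sumr_ge0 => u _; exact: opnorm_ge0.
Qed.

(** Eventually [v n <= u n <= esups u n], and the limit of [esups u] is the upper limit. *)
Lemma limn_esup_ge_cvg (u v : (\bar R) ^nat) (l : \bar R) :
  v @ \oo --> l -> (\forall n \near \oo, (v n <= u n)%E) -> (l <= limn_esup u)%E.
Proof.
move=> vl vu; rewrite limn_esup_lim -(cvg_lim _ vl)//; apply: lee_lim.
- by apply/cvg_ex; exists l.
- exact: is_cvg_esups.
- apply: filterS vu => n vun; apply: (le_trans vun).
  by apply: ereal_sup_ubound; exists n => /=.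
Qed.

Lemma cvg_powR_invn (c : R) : 0 < c -> c `^ n%:R^-1 @[n --> \oo] --> (1 : R).
Proof.
move=> c0; rewrite -cvg_shiftS/=.
have -> : (fun n => c `^ n.+1%:R^-1) = (fun n => expR (harmonic n * ln c)).
  by apply/funext => n; rewrite /powR gt_eqF.
rewrite -(expR0 R); apply: continuous_cvg; first exact: continuous_expR.
rewrite -[X in _ --> X](mul0r (ln c)); apply: cvgMl; exact: cvg_harmonic.
Qed.

(** The constant [c] disappears in the limit because its [n]-th root tends
    to [1]. *)
Lemma joint_spectral_radius_ge {D p : nat} (A : 'I_p -> 'M[R]_D) (c r : R) :
  0 < c -> 0 <= r ->
  (\forall n \near \oo, c * r ^+ n <= max_product_opnorm A n) ->
  (r%:E <= joint_spectral_radius A)%E.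
Proof.
move=> c0 r0 cr.
apply: (limn_esup_ge_cvg _ (fun n => (c `^ n%:R^-1 * r)%:E)).
  apply: cvg_EFin; first by near=> n.
  by rewrite -[X in _ --> X]mul1r; apply: cvgMl; exact: cvg_powR_invn.
near=> n; rewrite lee_fin.
have n0 : (n%:R : R) != 0 by rewrite pnatr_eq0 -lt0n; near: n; exists 1%N.
have -> : c `^ n%:R^-1 * r = (c * r ^+ n) `^ n%:R^-1.
  rewrite powRM ?(ltW c0) ?exprn_ge0//; congr (_ * _).
  by rewrite -powR_mulrn// -powRrM mulfV// powRr1.
have crn : c * r ^+ n <= max_product_opnorm A n by near: n.
have crn0 : 0 <= c * r ^+ n by rewrite mulr_ge0 ?(ltW c0) ?exprn_ge0.
by apply: ge0_ler_powR; rewrite ?invr_ge0// nnegrE// (le_trans crn0).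
Unshelve. all: by end_near. Qed.

End JointSpectralRadius.

(** * Orbits of the Hutchinson operator of linear maps *)

Section LinearHutchinson.
Context {R : realType} {D p : nat}.
Context (A : 'I_p -> 'M[R]_D) (f : 'I_p -> 'cV[R]_D -> 'cV[R]_D).
Context (fE : forall i x, f i x = A i *m x).
Implicit Types K : set 'cV[R]_D.

Lemma hutchinson_scale (a : R) K :
  hutchinson f (scale_set a K) = scale_set a (hutchinson f K).
Proof.
rewrite /hutchinson /scale_set image_bigcup; apply: eq_bigcupr => i _.
rewrite !image_comp; congr image; apply/funext => x /=.
by rewrite !fE scalemxAr.
Qed.

Lemma hutchinson_neq0 K : (0 < p)%N -> K !=set0 -> hutchinson f K !=set0.
Proof. by move=> p0 [x Kx]; exists (f (Ordinal p0) x), (Ordinal p0) => //; exists x. Qed.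

Lemma hutchinson_div_iter_neq0 (d : R) K n : (0 < p)%N -> K !=set0 ->
  iter n (hutchinson_div f d) K !=set0.
Proof.
move=> p0 K0; elim: n => // n IHn.
exact: scale_set_neq0 (hutchinson_neq0 _ p0 IHn).
Qed.

Lemma hutchinson_div_iter_word (d : R) K n x :
  iter n (hutchinson_div f d) K x ->
  exists (w : {ffun 'I_n -> 'I_p}) (y : 'cV[R]_D),
    K y /\ x = d ^- n *: (\prod_(k < n) A (w k) *m y).
Proof.
elim: n x => [|n IHn] x.
  move=> Kx; have w0 : 'I_0 -> 'I_p by case.
  by exists (finfun w0), x; rewrite big_ord0 expr0 invr1 scale1r mul1mx.
move=> [_ [i _ [z /IHn [w [y [Ky ->]]] <-]] <-].
exists [ffun k => oapp w i (unlift ord0 k)], y; split => //.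
rewrite big_ord_recl !ffunE unlift_none/= fE -scalemxAr scalerA -exprVn -exprS exprVn.
congr (_ *: _); rewrite -mulmxA; congr (_ *m (_ *m _)).
by apply: eq_bigr => k _; rewrite ffunE liftK.
Qed.

(** Serves twice: it shows that the iterates are bounded, and it bounds the
    norms of products of matrices from below. *)
Lemma enorm_hutchinson_div_iter_le (d : R) K n x : 0 < d -> ebounded K ->
  iter n (hutchinson_div f d) K x ->
  enorm x <= d ^- n * (max_product_opnorm A n * set_radius K).
Proof.
move=> d0 bK /hutchinson_div_iter_word [w [y [Ky ->]]].
have dn0 : 0 <= d ^- n by rewrite invr_ge0 exprn_ge0// ltW.
rewrite enormZ ger0_norm// ler_wpM2l// (le_trans (enorm_mulmx_le _ _))//.
by rewrite ler_pM ?opnorm_ge0 ?enorm_ge0 ?opnorm_prod_le_max ?enorm_le_radius.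
Qed.

Lemma ebounded_hutchinson_div_iter (d : R) K n : 0 < d -> ebounded K ->
  ebounded (iter n (hutchinson_div f d) K).
Proof.
move=> d0 bK; exists (d ^- n * (max_product_opnorm A n * set_radius K)) => x.
exact: enorm_hutchinson_div_iter_le.
Qed.


(** By induction, the [n]-th renormalized set is a positive multiple [c] of
    [U n]; since [H] is positively homogeneous, [c] cancels in the next
    renormalization. The formulas start at index [n.+1] because the initial
    set need not have radius one. *)
Lemma renorm_orbit_scale (d : R) K : (0 < p)%N -> 0 < d ->
  K !=set0 -> ebounded K -> (forall n, 0 < renorm_factor f K n) ->
  let U n := iter n (hutchinson_div f d) K in
  forall n, [/\ 0 < set_radius (U n.+1),
    renorm_orbit f K n.+1 = scale_set (set_radius (U n.+1))^-1 (U n.+1) &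
    renorm_factor f K n.+1 = d * (set_radius (U n.+2) / set_radius (U n.+1))].
Proof.
move=> p0 d0 K0 bK factor_gt0 U.
have bU n : ebounded (U n) by exact: ebounded_hutchinson_div_iter.
have U0 n : U n !=set0 by exact: hutchinson_div_iter_neq0.
(* The first step has [c = 1], the later ones the inverse of the radius. *)
have step n (c : R) : 0 < c -> renorm_orbit f K n = scale_set c (U n) ->
    [/\ renorm_factor f K n = c * d * set_radius (U n.+1),
      0 < set_radius (U n.+1) &
      renorm_orbit f K n.+1 = scale_set (set_radius (U n.+1))^-1 (U n.+1)].
  move=> c0 Kn.
  have HKn : hutchinson f (renorm_orbit f K n) = scale_set (c * d) (U n.+1).
    rewrite Kn hutchinson_scale /U iterS /hutchinson_div scale_set_comp.
    by rewrite mulfK// gt_eqF.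
  have dn : renorm_factor f K n = c * d * set_radius (U n.+1).
    by rewrite /renorm_factor HKn set_radius_scale// mulr_ge0// ltW.
  have rho_gt0 : 0 < set_radius (U n.+1).
    by have := factor_gt0 n; rewrite dn pmulr_rgt0// mulr_gt0.
  split => //.
  have -> : renorm_orbit f K n.+1 = scale_set (renorm_factor f K n)^-1
      (hutchinson f (renorm_orbit f K n)) by [].
  rewrite dn HKn scale_set_comp; congr scale_set.
  by rewrite invfM mulrAC mulVf ?mul1r// gt_eqF// mulr_gt0.
have rho_gt0 n : 0 < set_radius (U n.+1) /\
    renorm_orbit f K n.+1 = scale_set (set_radius (U n.+1))^-1 (U n.+1).
  elim: n => [|n [rho_gt0 Kn]].
    have K1 : renorm_orbit f K 0 = scale_set 1 (U 0%N) by rewrite scale_set1.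
    by have [] := step 0%N 1 ltr01 K1.
  by have [] := step n.+1 _ _ Kn; rewrite ?invr_gt0.
move=> n; have [rho_gt0n Kn] := rho_gt0 n; split => //.
have rhoV_gt0 : 0 < (set_radius (U n.+1))^-1 by rewrite invr_gt0.
by have [-> _ _] := step n.+1 _ rhoV_gt0 Kn; rewrite mulrAC mulrC [_^-1 * _]mulrC.
Qed.

(** A point of the [n]-th iterate with norm close to the radius bounds from
    below the norm of a product of [n] matrices, so radii bounded away from zero
    force products of size at least a constant times [d ^ n]. *)
Lemma le_joint_spectral_radius (d r : R) K : 0 < d -> 0 < r ->
  (0 < p)%N -> K !=set0 -> ebounded K ->
  (\forall n \near \oo, r <= set_radius (iter n (hutchinson_div f d) K)) ->
  (d%:E <= joint_spectral_radius A)%E.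
Proof.
move=> d0 r0 p0 K0 bK rU.
have growth n : r <= set_radius (iter n (hutchinson_div f d) K) ->
    r * d ^+ n <= max_product_opnorm A n * set_radius K.
  move=> /le_trans -/(_ (d ^- n * (max_product_opnorm A n * set_radius K))) rn.
  rewrite -ler_pdivlMr ?exprn_gt0// mulrC; apply: rn.
  apply: set_radius_le; first exact: hutchinson_div_iter_neq0.
  by move=> x; exact: enorm_hutchinson_div_iter_le.
(* If [K] had radius zero, so would all its iterates. *)
have rhoK : 0 < set_radius K.
  rewrite lt_neqAle set_radius_ge0 andbT; apply/negP => /eqP rho0.
  have [N _ /(_ N (leqnn N)) /growth] := rU.
  by rewrite -rho0 mulr0 leNgt mulr_gt0// exprn_gt0.
apply: (joint_spectral_radius_ge A (r / set_radius K)); [exact: divr_gt0|exact: ltW|].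
by apply: filterS rU => n /growth; rewrite mulrAC ler_pdivrMr.
Qed.

End LinearHutchinson.

(** * Hausdorff convergence *)

Section HausdorffConvergence.
Context {R : realType} {D : nat} (U : nat -> set 'cV[R]_D) (L : set 'cV[R]_D).
Context (bU : forall n, ebounded (U n)) (U0 : forall n, U n !=set0).
Context (bL : ebounded L) (L0 : L !=set0) (cvg_L : hausdorff_cvg U L).

Lemma cvg_set_radius : set_radius (U n) @[n --> \oo] --> set_radius L.
Proof.
apply/cvgrPdist_le => e e0; have /cvgrPdist_le/(_ e e0) := cvg_L.
apply: filterS => n; rewrite sub0r normrN => Une.
rewrite distrC (le_trans (set_radius_lipschitz _ _ (bU n) bL (U0 n) L0))//.
exact: le_trans (ler_norm _) Une.
Qed.

Lemma hausdorff_cvg_scale (a : nat -> R) (b : R) :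
  a n @[n --> \oo] --> b ->
  hausdorff_cvg (fun n => scale_set (a n) (U n)) (scale_set b L).
Proof.
move=> ab; rewrite /hausdorff_cvg.
pose bound n := `|a n| * hausdorff_dist (U n) L + `|a n - b| * set_radius L.
apply: (@squeeze_cvgr _ _ _ _ (fun=> 0) bound); last 2 first.
- exact: cvg_cst.
- rewrite -[X in _ --> X](_ : `|b| * 0 + `|b - b| * set_radius L = 0); last first.
    by rewrite subrr normr0 mul0r mulr0 addr0.
  apply: cvgD; first by apply: cvgM; [exact: cvg_norm|exact: cvg_L].
  by apply: cvgMl; apply: cvg_norm; apply: cvgB => //; exact: cvg_cst.
- apply: nearW => n; rewrite hausdorff_dist_scale// andbT.
  by apply: hausdorff_dist_ge0; do ?[exact: ebounded_scale|exact: scale_set_neq0].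
Qed.

End HausdorffConvergence.

Theorem proposition3p1 (R : realType) (D p : nat) (D_ge1 : (1 <= D)%N)
    (p_ge1 : (1 <= p)%N)
    (A : 'I_p -> 'M[R]_D) (f : 'I_p -> 'cV[R]_D -> 'cV[R]_D)
    (fE : forall i x, f i x = A i *m x)
    (K0 : set 'cV[R]_D) (K0_compact : nonempty_compact K0)
    (d_gt0 : forall n : nat, 0 < renorm_factor f K0 n)
    (d : R) (L : set 'cV[R]_D) (d_pos : 0 < d)
    (L_compact : nonempty_compact L) (radius_L : set_radius L != 0)
    (cvg_L : hausdorff_cvg (fun n => iter n (hutchinson_div f d) K0) L) :
  (renorm_factor f K0 n @[n --> \oo] --> d /\
   (d%:E <= joint_spectral_radius A)%E) /\
  hausdorff_cvg (renorm_orbit f K0) (scale_set (set_radius L)^-1 L).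
Proof.
have [[K0_neq0 /compact_ebounded bK0] [L_neq0 /compact_ebounded bL]] :=
  (K0_compact, L_compact).
pose U n := iter n (hutchinson_div f d) K0.
have bU n : ebounded (U n) by exact: ebounded_hutchinson_div_iter.
have U_neq0 n : U n !=set0 by exact: hutchinson_div_iter_neq0.
have orbit n := renorm_orbit_scale A f fE d K0 p_ge1 d_pos K0_neq0 bK0 d_gt0 n.
have rhoU : set_radius (U n) @[n --> \oo] --> set_radius L.
  exact: cvg_set_radius.
have rhoU1 : set_radius (U n.+1) @[n --> \oo] --> set_radius L.
  by move: rhoU; rewrite -[X in X -> _]cvg_shiftS.
have rhoU2 : set_radius (U n.+2) @[n --> \oo] --> set_radius L.
  by move: rhoU1; rewrite -[X in X -> _]cvg_shiftS.
have rhoL_gt0 : 0 < set_radius L by rewrite lt_neqAle eq_sym radius_L set_radius_ge0.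
split; first split.
- rewrite -cvg_shiftS/=.
  have -> : (fun n => renorm_factor f K0 n.+1) =
      (fun n => d * (set_radius (U n.+2) / set_radius (U n.+1))).
    by apply/funext => n; have [] := orbit n.
  suff : d * (set_radius (U n.+2) / set_radius (U n.+1)) @[n --> \oo] -->
      d * (set_radius L / set_radius L) by rewrite mulfV// mulr1.
  by apply: cvgMr; apply: cvgM => //; exact: cvgV.
- apply: (le_joint_spectral_radius A f fE d (set_radius L / 2) K0) => //.
    by rewrite divr_gt0.
  have /cvgr_ge := rhoU; apply.
  by rewrite ltr_pdivrMr// ltr_pMr// ltr1n.
- rewrite /hausdorff_cvg -cvg_shiftS/=.
  have -> : (fun n => hausdorff_dist (renorm_orbit f K0 n.+1)
        (scale_set (set_radius L)^-1 L)) =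
      (fun n => hausdorff_dist (scale_set (set_radius (U n.+1))^-1 (U n.+1))
        (scale_set (set_radius L)^-1 L)).
    by apply/funext => n; have [_ ->] := orbit n.
  apply: (hausdorff_cvg_scale (fun n => U n.+1)) => //; last exact: cvgV.
  by move: cvg_L; rewrite /hausdorff_cvg -[X in X -> _]cvg_shiftS.
Qed.
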